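(* Let $\sigma$ be a well-marked, primitive, non-periodic substitution over $\mathbb{A}=\{a,b\}$ having non-negative eigenvalues (that is, its incidence matrix $M$ has non-negative eigenvalues). Let $\xi$ be a fixed point of $\sigma$ and let $s(n)$ be the number of (right) special words of $\xi$ of length $n$. With the integers $N_k^j$, $c_k$ and the integer intervals $I^j$, $I_k^j$ defined in the context, for $n\in[N_1^0,\infty)=\bigcup_{j=0}^{\infty} I^j$ the following recurrence formula holds: $$s(n+1)=s(N_1^j)+\sum_{k=1}^{K}(c_1+\cdots+c_k)\,\chi_{I_k^j}(n)\qquad (n\in I^j,\ j\ge 0).$$
   Context: Words and substitutions. $\mathbb{A}^*$ is the set of finite words over $\mathbb{A}=\{a,b\}$, $\varepsilon$ is the empty word, $|W|$ is the length of $W$. A substitution is a morphism $\sigma:\mathbb{A}^*\to\mathbb{A}^*$ with $\sigma(a),\sigma(b)\neq\varepsilon$, extended to infinite words. Write $A=\sigma(a)$, $B=\sigma(b)$. It is well-marked if $A$ begins with $a$ and $B$ begins with $b$. Its incidence matrix $M$ has as columns the vectors $(|A|_a,|A|_b)^t$ and $(|B|_a,|B|_b)^t$, where $|W|_c$ is the number of occurrences of the letter $c$ in $W$. It is primitive if some power $M^n$, $n\ge1$, has all entries positive. A fixed point is an infinite word $\xi=\xi_1\xi_2\cdots$ with $\sigma(\xi)=\xi$; $\sigma$ is non-periodic if $\xi$ is not ultimately periodic. $\mathbb{N}=\{0,1,2,\dots\}$. The word $W_0$ and the map $T$. $W_0$ is the longest common suffix of the (distinct) left-infinite words $\cdots AAA$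 and $\cdots BBB$. The map $T:\mathbb{A}^*\to\mathbb{A}^*$ is $T(W)=W_0\sigma(W)$. The constant $L$. Let $E_1=\{|\sigma(\xi_1\cdots\xi_{k-1})|+1 : k\ge1\}$ (cutting positions). Let $C$ be an integer (depending on $\sigma$) such that whenever $\xi_{i-C}\cdots\xi_{i+C}=\xi_{j-C}\cdots\xi_{j+C}$ and $i\in E_1$, then $j\in E_1$ (such a $C$ exists by a theorem of Mossé). Put $L=\max\{2C+\max\{|A|,|B|\},\ |A|+|B|-1\}$. Special words. A factor $W$ of $\xi$ is (right) special if both $Wa$ and $Wb$ are factors of $\xi$; $\mathcal S$ is the set of special words. $\mathcal S^0$ (weak) is the set of $W\in\mathcal S$ with neither $aW$ nor $bW$ in $\mathcal S$; $\mathcal S^2$ (strong) is the set of $W\in\mathcal S$ with both $aW,bW\in\mathcal S$. For $i\in\{0,2\}$, $\widetilde{\mathcal S^i}=\{W\in\mathcal S^i: 1\le|W|\le L,\ |T(W)|>L\}$. The set of initial special words is $\widetilde{\mathcal S}=\widetilde{\mathcal S^0}\cup\widetilde{\mathcal S^2}=\{S_1,S_2,\dots,S_K\}$. For a word $W$, $\mathrm{sgn}(W)=-1$ if $W\in\widetilde{\mathcal S^0}$, $1$ if $W\in\widetilde{\mathcal S^2}$, and $0$ otherwise. The integers $m_1,m_2$. For all $W_1,W_2\in\mathbb{A}^*$ there exist $m_1=m_1(W_1,W_2),\ m_2=m_2(W_1,W_2)\in\mathbb{N}$ such that one of the following alternatives holds; these are the integers $m_1(W_1,W_2),m_2(W_1,W_2)$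 used below: (1) $|T^{m_1}(W_1)|=|T^{m_2}(W_2)|<|T^{m_1+1}(W_1)|=|T^{m_2+1}(W_2)|<|T^{m_1+2}(W_1)|=|T^{m_2+2}(W_2)|<\cdots$; (2) $|T^{m_1}(W_1)|<|T^{m_2}(W_2)|<|T^{m_1+1}(W_1)|<|T^{m_2+1}(W_2)|<|T^{m_1+2}(W_1)|<|T^{m_2+2}(W_2)|<\cdots$. Derived data. Define $n_1$ by $n_1-1=\max\{\max\{m_1(W_1,W_2),m_2(W_1,W_2)\}: W_1,W_2\in\widetilde{\mathcal S}\}$. For $2\le j\le K$ let $n_j\in\mathbb{N}$ be the unique integer with $|T^{n_1}(S_1)|\le|T^{n_j}(S_j)|<|T^{n_1+1}(S_1)|$. Without loss of generality the words $S_2,\dots,S_K$ are labelled so that $|T^{n_1}(S_1)|\le|T^{n_2}(S_2)|\le\cdots\le|T^{n_K}(S_K)|\le|T^{n_1+1}(S_1)|$. For $1\le k\le K$ and $j\in\mathbb{N}$ put $N_k^j=|T^{j}(T^{n_k}(S_k))|$, and put $N_{K+1}^j=N_1^{j+1}$. All intervals are integer intervals: $I^j=[N_1^j,N_1^{j+1})$, which is the disjoint union of the subintervals $I_k^j=[N_k^j,N_{k+1}^j)$, $1\le k\le K$. $\chi_J$ is the indicator function of $J$. Finally, for $1\le k\le K$, $$c_k=\sum_{i=1}^{K}\mathrm{sgn}(S_i)\,\delta\big(|T^{n_i}(S_i)|,|T^{n_k}(S_k)|\big),$$ where $\delta(i,j)=1$ if $i=j$ and $0$ otherwise.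
   Formalization: In c_1+...+c_k, indices l with empty I_l^j are skipped, so tied lengths count once; the literal formula fails for a->ab, b->ba (c=(2,2,-2,-2)). K>=1 is assumed so that S_1 exists, and the m_1, m_2 alternatives are required only for non-empty words. *)

(* Defs.v *)
From HB Require Import structures.
From mathcomp Require Import all_boot all_order all_algebra all_field.
From mathcomp Require Import boolp.

Set Implicit Arguments.
Unset Strict Implicit.
Unset Printing Implicit Defensive.

Import Order.TTheory GRing.Theory Num.Theory.

(* The alphabet {a, b} is bool, with a = false and b = true. *)
Notation letter := bool (only parsing).
Notation word := (seq bool) (only parsing).
Notation la := false (only parsing).
Notation lb := true (only parsing).

(* A substitution is given by its values on the two letters; [subst sg] is the
   morphism of the free monoid that extends it. *)
Definition subst (sg : letter -> word) (w : word) : word := flatten (map sg w).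

Definition nonerasing (sg : letter -> word) : Prop := forall x, sg x != [::].

Definition well_marked (sg : letter -> word) : Prop :=
  ohead (sg la) = Some la /\ ohead (sg lb) = Some lb.

Definition letter_of (i : 'I_2) : letter := i != ord0.

Definition incidence (sg : letter -> word) : 'M[int]_2 :=
  (\matrix_(i < 2, j < 2) (count_mem (letter_of i) (sg (letter_of j)))%:Z)%R.

Definition primitive (sg : letter -> word) : Prop :=
  exists2 n : nat, (1 <= n)%N
    & forall i j : 'I_2, (0 < (incidence sg ^+ n) i j)%R.

(* In algC, 0 <= lam means that lam is real and non-negative. *)
Definition nonneg_eigenvalues (sg : letter -> word) : Prop :=
  forall lam : algC,
    eigenvalue (map_mx (fun z : int => z%:~R%R : algC) (incidence sg)) lam ->
    (0 <= lam)%R.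

(* Infinite words are functions on nat, so positions are 0-based: the letter
   xi_i of the 1-based convention is [xi i.-1]. *)
Definition prefix_of (xi : nat -> letter) (n : nat) : word := mkseq xi n.

(* For nonerasing sg, the n-th letter of sg(xi) already occurs in the image of
   the prefix of xi of length n + 1. *)
Definition subst_inf (sg : letter -> word) (xi : nat -> letter) : nat -> letter :=
  fun n => nth la (subst sg (prefix_of xi n.+1)) n.

Definition fixed_point (sg : letter -> word) (xi : nat -> letter) : Prop :=
  subst_inf sg xi =1 xi.

Definition ultimately_periodic (xi : nat -> letter) : Prop :=
  exists p n0 : nat, (0 < p)%N /\ forall n, (n0 <= n)%N -> xi (n + p) = xi n.

Definition factor (xi : nat -> letter) (w : word) : Prop :=
  exists i : nat, w = mkseq (fun t => xi (i + t)) (size w).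

Definition special (xi : nat -> letter) (w : word) : Prop :=
  factor xi (rcons w la) /\ factor xi (rcons w lb).

Definition num_special (xi : nat -> letter) (n : nat) : nat :=
  #|[set w : n.-tuple letter | `[< special xi w >]]|.

Definition weak (xi : nat -> letter) (w : word) : Prop :=
  [/\ special xi w, ~ special xi (la :: w) & ~ special xi (lb :: w)].

Definition strong (xi : nat -> letter) (w : word) : Prop :=
  [/\ special xi w, special xi (la :: w) & special xi (lb :: w)].

(* [w] is a suffix of the left-infinite word ...UUU. *)
Definition suffix_of_power (U w : word) : Prop :=
  exists k : nat, suffix w (flatten (nseq k U)).

Definition longest_common_suffix (U V w : word) : Prop :=
  [/\ suffix_of_power U w, suffix_of_power V w
    & forall v, suffix_of_power U v -> suffix_of_power V v ->
        (size v <= size w)%N].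

Definition Tmap (sg : letter -> word) (W0 : word) (w : word) : word :=
  W0 ++ subst sg w.

(* Cutting positions, shifted by one because positions are 0-based. *)
Definition cutting (sg : letter -> word) (xi : nat -> letter) (p : nat) : Prop :=
  exists k : nat, p = size (subst sg (prefix_of xi k)).

(* Only positions i, j >= C are compared: for these the window of radius C
   lies inside the one-sided word xi. *)
Definition recognizability_constant
    (sg : letter -> word) (xi : nat -> letter) (C : nat) : Prop :=
  forall i j : nat, (C <= i)%N -> (C <= j)%N ->
    mkseq (fun t => xi (i - C + t)) (2 * C).+1 =
    mkseq (fun t => xi (j - C + t)) (2 * C).+1 ->
    cutting sg xi i -> cutting sg xi j.

Definition Lconst (sg : letter -> word) (C : nat) : nat :=
  maxn (2 * C + maxn (size (sg la)) (size (sg lb)))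
       (size (sg la) + size (sg lb) - 1).

Definition in_range (T : word -> word) (L : nat) (w : word) : Prop :=
  [/\ (1 <= size w)%N, (size w <= L)%N & (L < size (T w))%N].

Definition initial_weak xi (T : word -> word) (L : nat) (w : word) : Prop :=
  weak xi w /\ in_range T L w.

Definition initial_strong xi (T : word -> word) (L : nat) (w : word) : Prop :=
  strong xi w /\ in_range T L w.

Definition initial_special xi (T : word -> word) (L : nat) (w : word) : Prop :=
  initial_weak xi T L w \/ initial_strong xi T L w.

Definition sgn xi (T : word -> word) (L : nat) (w : word) : int :=
  if `[< initial_weak xi T L w >] then (-1)%R
  else if `[< initial_strong xi T L w >] then 1%R else 0%R.

(* Ss 1, ..., Ss K lists the initial special words without repetition. *)
Definition enumerates_initial xi (T : word -> word) (L K : nat)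
    (Ss : nat -> word) : Prop :=
  (forall i j, (1 <= i <= K)%N -> (1 <= j <= K)%N -> Ss i = Ss j -> i = j) /\
  (forall w, initial_special xi T L w <->
             exists2 k, (1 <= k <= K)%N & Ss k = w).

Definition Tlen (T : word -> word) (m : nat) (w : word) : nat :=
  size (iter m T w).

Definition same_lengths (T : word -> word) (W1 W2 : word) (m1 m2 : nat) : Prop :=
  forall i, Tlen T (m1 + i) W1 = Tlen T (m2 + i) W2 /\
            (Tlen T (m2 + i) W2 < Tlen T (m1 + i).+1 W1)%N.

Definition interlaced_lengths (T : word -> word) (W1 W2 : word)
    (m1 m2 : nat) : Prop :=
  forall i, (Tlen T (m1 + i) W1 < Tlen T (m2 + i) W2)%N /\
            (Tlen T (m2 + i) W2 < Tlen T (m1 + i).+1 W1)%N.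

(* The empty word is excluded: if W0 is empty, then every T^m maps it to the
   empty word, and neither alternative can hold. *)
Definition length_comparison (T : word -> word)
    (m1 m2 : word -> word -> nat) : Prop :=
  forall W1 W2 : word, W1 != [::] -> W2 != [::] ->
    same_lengths T W1 W2 (m1 W1 W2) (m2 W1 W2) \/
    interlaced_lengths T W1 W2 (m1 W1 W2) (m2 W1 W2).

Definition first_exponent (m1 m2 : word -> word -> nat) (K : nat)
    (Ss : nat -> word) : nat :=
  (\max_(1 <= i < K.+1) \max_(1 <= j < K.+1)
     maxn (m1 (Ss i) (Ss j)) (m2 (Ss i) (Ss j))).+1.

Definition Npos (T : word -> word) (K : nat) (Ss : nat -> word)
    (e : nat -> nat) (k j : nat) : nat :=
  if k == K.+1 then Tlen T j.+1 (iter (e 1) T (Ss 1))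
  else Tlen T j (iter (e k) T (Ss k)).

Definition ccoef xi (T : word -> word) (L K : nat) (Ss : nat -> word)
    (e : nat -> nat) (k : nat) : int :=
  (\sum_(1 <= i < K.+1)
     sgn xi T L (Ss i) * (Tlen T (e i) (Ss i) == Tlen T (e k) (Ss k))%:R)%R.

(* The partial sum c_1 + ... + c_k at stage j.  When several words T^(e i)(Ss i)
   have the same length, each of their coefficients is already the total of
   their signs, so that total must be counted once only.  The sum therefore
   skips the indices l whose interval [N_l^j, N_(l+1)^j) is empty; when the
   lengths are distinct there are none.  Without this convention the recurrence
   fails for a -> ab, b -> ba, where the lengths are pairwise equal and
   c = (2, 2, -2, -2). *)
Definition csum xi (T : word -> word) (L K : nat) (Ss : nat -> word)
    (e : nat -> nat) (k j : nat) : int :=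
  (\sum_(1 <= l < k.+1 | (Npos T K Ss e l j < Npos T K Ss e l.+1 j)%N)
     ccoef xi T L K Ss e l)%R.

(* Main.v *)
(** Since the blocks A and B begin with different letters and recognizability
    locates the cutting positions inside words of length greater than L, every
    special word longer than L is a suffix of T(V) for some special V: the two
    continuations are read off from two prefixes of xi cut at the same place,
    and V is the longest common suffix of these prefixes. Hence weak (strong)
    words longer than L are exactly the images T(V) of weak (strong) words, and
    descending along T each of them is T^m(S_k) for a unique initial word S_k and
    a unique m > 0. As s(n+1) - s(n) is the number of strong minus the number of
    weak words of length n, only the order of the lengths |T^m(S_k)| matters.
    The first exponent n_1 exceeds all the comparison thresholds; since
    |T^(m+2)(S_1)| > |T^m(S_k)| always holds, every n_k is at least n_1 - 1, so
    that the order of the lengths at level 0 is the order at all levels. *)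
Require Import Defs.
From HB Require Import structures.
From mathcomp Require Import all_boot all_order all_algebra all_field.
From mathcomp Require Import boolp.
From mathcomp Require Import zify ring.

Import Order.TTheory GRing.Theory Num.Theory.

(** * Counting over tuples and intervals *)

Section Counting.
Set Implicit Arguments.
Unset Strict Implicit.

Lemma sum_eq_nat (a b x : nat) : a <= x ->
  (\sum_(a <= m < b) (x == m)%:R = (x < b)%N%:R :> int)%R.
Proof.
move=> Hax; elim: b => [|b IHb]; first by rewrite big_geq.
have [Hab|Hba] := leqP a b.
  rewrite big_nat_recr //= IHb ltnS [(x <= b)]leq_eqVlt.
  by case: eqVneq => [->|_]; rewrite ?ltnn ?addr0 ?add0r.
by rewrite big_geq // ltnNge (leq_trans _ Hax).
Qed.

Lemma sum_tuple_eq n (u : word) :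
  (\sum_(w : n.-tuple letter) (u == w)%:R = (size u == n)%:R :> int)%R.
Proof.
case: eqP => [E|Hn]; last first.
  by apply: big1 => w _; case: eqP => // Eu; case: Hn; rewrite Eu size_tuple.
have Hu : size u == n by apply/eqP.
rewrite (bigD1 (Tuple Hu)) //= eqxx big1 ?addr0 // => w Hw.
by case: eqP => // Eu; case/eqP: Hw; apply: val_inj.
Qed.

Lemma sum_tuple_cons n (F : word -> int) :
  (\sum_(w : n.+1.-tuple letter) F w =
     \sum_(w : n.-tuple letter) F (la :: w) + \sum_(w : n.-tuple letter) F (lb :: w))%R.
Proof.
pose h (p : letter * n.-tuple letter) : n.+1.-tuple letter := [tuple of p.1 :: p.2].
have Hh : bijective h.
  exists (fun w => (thead w, [tuple of behead w])) => [[c w]|w].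
    by congr pair; apply: val_inj.
  by apply: val_inj; case/tupleP: w.
rewrite (reindex h) /=; last exact: onW_bij.
rewrite -(pair_bigA _ (fun c (w : n.-tuple letter) => F (c :: w))) /=.
by rewrite big_bool addrC.
Qed.

(** * Partial sums over consecutive intervals *)

Variables (K : nat) (N : nat -> nat).
Hypothesis N_homo : forall k, 1 <= k <= K -> N k <= N k.+1.

Lemma N_le i k : 1 <= i -> i <= k -> k <= K.+1 -> N i <= N k.
Proof.
move=> Hi /subnKC <-; elim: (k - i) => [|d IHd]; first by rewrite addn0.
rewrite addnS => Hd; apply: leq_trans (IHd _) (N_homo _); lia.
Qed.

Lemma interval_indicator a b n : a <= b ->
  ((a <= n < b)%N%:R = (a <= n)%N%:R - (b <= n)%N%:R :> int)%R.
Proof.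
move=> Hab; rewrite ltnNge; case: (leqP b n) => Hb; rewrite ?andbT ?subr0 //.
by rewrite (leq_trans Hab Hb) subrr.
Qed.

(** Abel summation: the indicator of an interval is the difference of the threshold indicators of
    its ends, and consecutive partial sums differ by [g l] or by zero. *)
Lemma sum_partial_sums (P : pred nat) (g : nat -> int) n k : k <= K ->
  (\sum_(1 <= i < k.+1) (\sum_(1 <= l < i.+1 | P l) g l) * (N i <= n < N i.+1)%N%:R
   = \sum_(1 <= l < k.+1 | P l) g l * (N l <= n)%N%:R
     - (\sum_(1 <= l < k.+1 | P l) g l) * (N k.+1 <= n)%N%:R)%R.
Proof.
elim: k => [|k IHk] Hk; first by rewrite !big_geq // mul0r subr0.
rewrite big_nat_recr //= (IHk (ltnW Hk)) interval_indicator ?N_homo //.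
have Erec (f : nat -> int) : (\sum_(1 <= l < k.+2 | P l) f l =
    \sum_(1 <= l < k.+1 | P l) f l + (if P k.+1 then f k.+1 else 0))%R.
  by rewrite big_mkcond big_nat_recr //= -big_mkcond.
rewrite !Erec; case: (P k.+1); ring.
Qed.

(* The indices l with N l < N (l+1) pick out exactly one representative of
   every class of indices on which N is constant. *)
Lemma sum_last_of_class x : N 1 <= x < N K.+1 ->
  (exists2 i, 1 <= i <= K & N i = x) ->
  (\sum_(1 <= l < K.+1 | (N l < N l.+1)%N) (x == N l)%:R = 1%R :> int)%R.
Proof.
move=> /andP[Hx1 HxK] [i Hi Ex]; rewrite big_mkcond /=.
(* As [x] is a value of the monotone [N], it lies in a nonempty interval from [N l] to [N l.+1] only
   as its left end, so the sum telescopes in threshold indicators. *)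
pose f l : int := (- (N l <= x)%N%:R)%R.
transitivity (\sum_(1 <= l < K.+1) (f l.+1 - f l))%R; last first.
  by rewrite telescope_sumr // /f Hx1 leqNgt HxK oppr0 add0r opprK.
apply: eq_big_nat => l /andP[Hl1 HlK].
rewrite /f opprK addrC -interval_indicator; last by apply: N_homo; lia.
case: ltnP => HlN; last by case: andP => // -[H1 H2]; lia.
congr (_%:R)%R; congr nat_of_bool; apply/eqP/andP => [->|[H1 H2]]; first by [].
have [Hil|Hli] := leqP i l; first by have := N_le (i := i) (k := l); lia.
by have := N_le (i := l.+1) (k := i); lia.
Qed.

(** After Abel summation the double sum is exchanged, and each [i] is counted through the single
    representative of its class. *)
Lemma sum_partial_class_sums (s : nat -> int) n : N 1 <= n < N K.+1 ->
  (forall k, 1 <= k <= K -> N 1 <= N k < N K.+1) ->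
  (\sum_(1 <= k < K.+1)
     (\sum_(1 <= l < k.+1 | (N l < N l.+1)%N)
        \sum_(1 <= i < K.+1) s i * (N i == N l)%:R) * (N k <= n < N k.+1)%N%:R
   = \sum_(1 <= i < K.+1) s i * (N i <= n)%N%:R)%R.
Proof.
move=> /andP[_ HnK] HN; rewrite sum_partial_sums // [N K.+1 <= n]leqNgt HnK mulr0 subr0.
under eq_bigr do rewrite mulr_suml.
rewrite exchange_big; apply: eq_big_nat => i Hi /=.
transitivity (s i * (N i <= n)%N%:R *
    \sum_(1 <= l < K.+1 | (N l < N l.+1)%N) (N i == N l)%:R)%R; last first.
  by rewrite sum_last_of_class ?mulr1 ?HN //; exists i.
rewrite mulr_sumr; apply: eq_bigr => l _.
by rewrite mulrAC; case: eqP => [->|_] //; rewrite !mulr0.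
Qed.
End Counting.

(** * Words, special words and the map T *)

Section Words.
Set Implicit Arguments.
Unset Strict Implicit.

Variable sg : letter -> word.

Lemma subst_cat u v : subst sg (u ++ v) = subst sg u ++ subst sg v.
Proof. by rewrite /subst map_cat flatten_cat. Qed.

Lemma subst_cons c v : subst sg (c :: v) = sg c ++ subst sg v.
Proof. by []. Qed.

Lemma subst_rcons v c : subst sg (rcons v c) = subst sg v ++ sg c.
Proof. by rewrite -cats1 subst_cat /subst /= cats0. Qed.

Lemma count_subst c w :
  count_mem c (subst sg w) =
    count_mem c (sg la) * count_mem la w + count_mem c (sg lb) * count_mem lb w.
Proof.
elim: w => [|d w IHw]; first by rewrite !muln0.
rewrite subst_cons count_cat IHw; case: d => /=; lia.
Qed.

Lemma size_count (w : word) : size w = count_mem la w + count_mem lb w.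
Proof. by elim: w => [|[] w /= ->] //=; lia. Qed.

Hypothesis marked : forall c, ohead (sg c) = Some c.

Lemma nth_marked c d : nth d (sg c) 0 = c.
Proof. by have := marked c; case: (sg c) => //= e s [->]. Qed.

Lemma cat_marked c : exists s, sg c = c :: s.
Proof. by have := marked c; case: (sg c) => //= e s [->]; exists s. Qed.

Lemma size_sg_gt0 c : 0 < size (sg c).
Proof. by have [s ->] := cat_marked c. Qed.

(** Marked blocks are decoded from left to right: the first letter of an image determines the first
    block. *)
Lemma subst_inj : injective (subst sg).
Proof.
elim=> [|c u IHu] [|d v] //.
- by rewrite subst_cons; have [s ->] := cat_marked d.
- by rewrite subst_cons; have [s ->] := cat_marked c.
rewrite !subst_cons => E.
have Ecd : c = d.
  by move: E; have [s ->] := cat_marked c; have [t ->] := cat_marked d; case.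
move: E; rewrite Ecd => /(congr1 (drop (size (sg d)))).
by rewrite !drop_size_cat // => /IHu ->.
Qed.

(** * Growth of lengths when every block contains both letters *)

Hypothesis full : forall c d, 0 < count_mem d (sg c).

Lemma size_sg_gt1 c : 1 < size (sg c).
Proof. by rewrite size_count; have := full c la; have := full c lb; lia. Qed.

Lemma size_subst_ge w : 2 * size w <= size (subst sg w).
Proof.
elim: w => //= c w IHw; rewrite subst_cons size_cat.
have := size_sg_gt1 c; lia.
Qed.

Lemma size_subst_ge1 w : size w <= size (subst sg w).
Proof. by have := size_subst_ge w; lia. Qed.

Variable W0 : word.
Notation T := (Tmap sg W0).

Lemma T_inj : injective T.
Proof.
move=> u v /(congr1 (drop (size W0))); rewrite !drop_size_cat //.
exact: subst_inj.
Qed.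

Lemma iter_T_inj m : injective (iter m T).
Proof. by elim: m => // m IHm u v /= /T_inj /IHm. Qed.

Lemma size_T w : size (T w) = size W0 + size (subst sg w).
Proof. by rewrite size_cat. Qed.

Lemma size_T_ge w : 2 * size w <= size (T w).
Proof. by rewrite size_T; have := size_subst_ge w; lia. Qed.

Lemma Tlen_lt_S w m : w != [::] -> Tlen T m w < Tlen T m.+1 w.
Proof.
rewrite -size_eq0 -lt0n /Tlen => Hw.
suff : 0 < size (iter m T w) by have := size_T_ge (iter m T w); rewrite iterS; lia.
elim: m => // m IHm; have := size_T_ge (iter m T w); rewrite iterS; lia.
Qed.

Lemma Tlen_le w m n : m <= n -> Tlen T m w <= Tlen T n w.
Proof.
move=> /subnK <-; elim: (n - m) => // i IHi.
by apply: leq_trans IHi _; rewrite addSn /Tlen /=; have := size_T_ge (iter (i + m) T w); lia.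
Qed.

(* All entries of the incidence matrix are positive, so sigma(v) contains every
   letter at least |v| times, hence more often than it occurs in w. *)
Lemma Tlen_gt_of_size v w m :
  size w < size v -> Tlen T m w < Tlen T m.+1 v.
Proof.
move=> Hwv.
suff H c : count_mem c (iter m T w) < count_mem c (iter m.+1 T v).
  by rewrite /Tlen !size_count; have := H la; have := H lb; lia.
elim: m c => [|m IHm] c.
  apply: leq_ltn_trans (count_size _ _) _; apply: leq_trans Hwv _.
  rewrite size_count iterS count_cat count_subst.
  by apply: leq_trans _ (leq_addl _ _); apply: leq_add; apply: leq_pmull.
rewrite !iterS !count_cat !count_subst -iterS ltn_add2l.
by rewrite -addSn leq_add // ?ltn_pmul2l ?leq_pmul2l // ltnW.
Qed.

(** * Left branching of words under [T] *)

Hypothesis lcsW0 : longest_common_suffix (sg la) (sg lb) W0.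

Lemma W0_power c : suffix_of_power (sg c) W0.
Proof. by case: lcsW0; case: c. Qed.

Lemma flatten_nseqSr (U : word) k :
  flatten (nseq k.+1 U) = flatten (nseq k U) ++ U.
Proof. by elim: k => /= [|k IHk]; rewrite ?cats0 // -catA -IHk. Qed.

Lemma suffix_same_size (u v s : word) :
  suffix u s -> suffix v s -> size u = size v -> u = v.
Proof.
by rewrite !suffixE => /eqP Hu /eqP Hv Huv; rewrite -Hu -Hv Huv.
Qed.

Lemma suffix_le (u v s : word) :
  suffix u s -> suffix v s -> size u <= size v -> suffix u v.
Proof.
rewrite !suffixE => /eqP Hu Hv Huv.
have Hvs : size v <= size s by apply: size_suffix; rewrite suffixE.
have : drop (size v - size u) (drop (size s - size v) s) = u.
  by rewrite drop_drop addnC addnBA // subnK // Hu.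
by rewrite (eqP Hv) => /eqP.
Qed.


Lemma suffix_cat2r (u v s : word) : suffix u v -> suffix (u ++ s) (v ++ s).
Proof. by rewrite suffix_catl // eqxx. Qed.

(** Both words are suffixes of one power of [sg c], so the shorter is a suffix of the longer. *)
Lemma suffix_W0_sg c : suffix W0 (W0 ++ sg c).
Proof.
have [k Hk] := W0_power c.
apply: (@suffix_le _ _ (flatten (nseq k.+1 (sg c)))).
- exact: suffix_catr.
- by rewrite flatten_nseqSr; apply: suffix_cat2r.
- by rewrite size_cat leq_addr.
Qed.

Lemma suffix_W0_T w : suffix W0 (T w).
Proof.
elim/last_ind: w => [|w c IHw]; first by rewrite /Tmap cats0 suffix_refl.
rewrite /Tmap subst_rcons catA.
exact: suffix_trans (suffix_W0_sg c) (suffix_cat2r _ IHw).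
Qed.

Lemma suffix_T u v : suffix u v -> suffix (T u) (T v).
Proof.
case/suffixP=> p ->; rewrite /Tmap subst_cat catA.
exact: suffix_cat2r (suffix_W0_T p).
Qed.

Lemma suffix_cons_neq (u s : word) c d :
  suffix (c :: u) s -> suffix (d :: u) s -> c = d.
Proof. by move=> Hc Hd; case: (suffix_same_size Hc Hd erefl). Qed.

(* By maximality of W0, the letters preceding the suffix W0 in W0 A and in W0 B
   are distinct. *)
Lemma W0_marks : exists x : letter -> letter,
  injective x /\ forall c, suffix (x c :: W0) (W0 ++ sg c).
Proof.
have Hx c : exists x, suffix (x :: W0) (W0 ++ sg c).
  have /suffixP[p Ep] := suffix_W0_sg c.
  case/lastP: p Ep => [|p x] Ep; last by exists x; rewrite Ep cat_rcons suffix_suffix.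
  have := size_sg_gt0 c; have := congr1 size Ep; rewrite !size_cat /=; lia.
have [x Ha] := Hx la; have [y Hb] := Hx lb.
exists (fun c => if c then y else x); split; last by case.
suff : x <> y by move=> H [] [] // E; case: H.
move=> E; subst y.
have Hp c : suffix (x :: W0) (W0 ++ sg c) -> suffix_of_power (sg c) (x :: W0).
  have [k Hk] := W0_power c => H; exists k.+1; rewrite flatten_nseqSr.
  exact: suffix_trans H (suffix_cat2r _ Hk).
have [_ _ Hmax] := lcsW0.
by have := Hmax _ (Hp la Ha) (Hp lb Hb); rewrite /= ltnn.
Qed.

(** Read from the right, two words agree until one is exhausted or the letters differ. *)
Lemma suffix_compare (u v : word) :
  [\/ suffix u v, suffix v u
    | exists q c, suffix (c :: q) u /\ suffix (~~ c :: q) v].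
Proof.
elim/last_ind: u v => [|u c IHu] v; first by apply: Or31; rewrite suffix0s.
case/lastP: v => [|v d]; first by apply: Or32; rewrite suffix0s.
case: (eqVneq d c) => [->|Hdc].
  have [H|H|[q [e [H1 H2]]]] := IHu v.
  - by apply: Or31; rewrite -!cats1 suffix_cat2r.
  - by apply: Or32; rewrite -!cats1 suffix_cat2r.
  - by apply: Or33; exists (rcons q c), e; rewrite -!rcons_cons -!cats1 !suffix_cat2r.
apply: Or33; exists [::], c; rewrite -!cats1 !suffix_catr ?suffix_refl //.
by case: c d Hdc {IHu} => [] [].
Qed.

(** The letter to the left of [T q] depends only on the letter to the left of [q], and injectively:
    [T] carries the place where two words part to the place where their images part. *)
Lemma T_marks : exists x : letter -> letter,
  injective x /\ forall c q v, suffix (c :: q) v -> suffix (x c :: T q) (T v).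
Proof.
have [x [x_inj Hx]] := W0_marks; exists x; split=> // c q v /suffix_T.
apply: suffix_trans.
by rewrite /Tmap subst_cons catA -cat_cons; apply: suffix_cat2r.
Qed.

(** If [V] and [V'] part at [q], their images part exactly at [T q], so a common suffix of the
    images is no longer than [T q]. *)
Lemma T_common_suffix U V V' :
  suffix U (T V) -> suffix U (T V') ->
  exists Q, [/\ suffix Q V, suffix Q V' & suffix U (T Q)].
Proof.
move=> HV HV'; have [x [x_inj Hx]] := T_marks.
have [H|H|[q [c [H1 H2]]]] := suffix_compare V V'.
- by exists V; rewrite suffix_refl.
- by exists V'; rewrite suffix_refl.
exists q; split.
- exact: suffix_trans (suffix_cons _ _) H1.
- exact: suffix_trans (suffix_cons _ _) H2.
have Hc := Hx _ _ _ H1; have Hc' := Hx _ _ _ H2.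
have [Hle|Hlt] := leqP (size U) (size (T q)).
  by apply: suffix_le HV _ Hle; apply: suffix_trans (suffix_cons _ _) Hc.
have := suffix_cons_neq (suffix_le Hc HV Hlt) (suffix_le Hc' HV' Hlt).
by move/x_inj; case: (c).
Qed.

(** Images that part come from words that part at some [q], and then the images part exactly at
    [T q]; comparing the two places gives [U = T q]. *)
Lemma T_branch z U V V' :
  suffix (z :: U) (T V) -> suffix (~~ z :: U) (T V') ->
  exists Q c, [/\ U = T Q, suffix (c :: Q) V & suffix (~~ c :: Q) V'].
Proof.
move=> HV HV'; have [x [x_inj Hx]] := T_marks.
have Habs s : suffix (z :: U) s -> suffix (~~ z :: U) s -> False.
  by move=> H /(suffix_cons_neq H); case: (z).
have [H|H|[q [c [H1 H2]]]] := suffix_compare V V'.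
- by case: (Habs _ (suffix_trans HV (suffix_T H)) HV').
- by case: (Habs _ HV (suffix_trans HV' (suffix_T H))).
have Hc := Hx _ _ _ H1; have Hc' := Hx _ _ _ H2.
exists q, c; split=> //.
case: (ltngtP (size U) (size (T q))) => [Hlt|Hlt|Heq].
- have Hq := suffix_trans (suffix_cons _ _) Hc.
  have Hq' := suffix_trans (suffix_cons _ _) Hc'.
  by case: (Habs _ (suffix_le HV Hq Hlt) (suffix_le HV' Hq' Hlt)).
- have HU := suffix_trans (suffix_cons _ _) HV.
  have HU' := suffix_trans (suffix_cons _ _) HV'.
  have := suffix_cons_neq (suffix_le Hc HU Hlt) (suffix_le Hc' HU' Hlt).
  by move/x_inj; case: (c).
- have Hq := suffix_trans (suffix_cons _ _) Hc.
  have HU := suffix_trans (suffix_cons _ _) HV.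
  exact: suffix_same_size HU Hq Heq.
Qed.

(* Otherwise AB and BA, both suffixes of words ending in W0, would agree up to
   their first letters, hence also in these by counting. *)
Lemma size_W0 : size W0 + 2 <= size (sg la) + size (sg lb).
Proof.
rewrite leqNgt; apply/negP => Hlt.
have Hc c : suffix (behead (sg c ++ sg (~~ c))) W0.
  apply: (@suffix_le _ _ (W0 ++ sg c ++ sg (~~ c))).
  - by apply: suffix_catr; rewrite -drop1 suffix_drop.
  - rewrite catA; apply: suffix_trans (suffix_W0_sg (~~ c)) _.
    exact/suffix_cat2r/suffix_W0_sg.
  - rewrite size_behead size_cat; case: c => /=; lia.
have [s Es] := cat_marked la; have [t Et] := cat_marked lb.
have E : behead (sg la ++ sg lb) = behead (sg lb ++ sg la).
  apply: suffix_same_size (Hc la) (Hc lb) _.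
  by rewrite !size_behead !size_cat addnC.
move: E; rewrite Es Et /= => /(congr1 (count_mem la)).
rewrite !count_cat /=; lia.
Qed.

(** * Prefixes and factors of the infinite word *)

Variable xi : nat -> letter.

Definition xi_prefix (u : word) : Prop := u = prefix_of xi (size u).

Lemma size_prefix_of n : size (prefix_of xi n) = n.
Proof. exact: size_mkseq. Qed.

Lemma xi_prefix_of n : xi_prefix (prefix_of xi n).
Proof. by rewrite /xi_prefix size_prefix_of. Qed.

Lemma prefix_ofD m n :
  prefix_of xi (m + n) = prefix_of xi m ++ mkseq (fun t => xi (m + t)) n.
Proof.
rewrite /prefix_of /mkseq iotaD map_cat add0n; congr cat.
by rewrite -[in iota m n](addn0 m) iotaDl -map_comp.
Qed.

Lemma prefix_ofS n : prefix_of xi n.+1 = rcons (prefix_of xi n) (xi n).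
Proof. exact: mkseqS. Qed.

Lemma take_prefix_of m n : m <= n -> take m (prefix_of xi n) = prefix_of xi m.
Proof.
by move=> /subnKC <-; rewrite prefix_ofD take_size_cat ?size_prefix_of.
Qed.

Lemma xi_prefix_catl u v : xi_prefix (u ++ v) -> xi_prefix u.
Proof.
move=> /(congr1 (take (size u))).
by rewrite take_size_cat // size_cat take_prefix_of // leq_addr.
Qed.

Lemma xi_prefix_ext u v :
  xi_prefix u -> xi_prefix v -> size u <= size v -> exists s, v = u ++ s.
Proof.
move=> Hu Hv Huv; exists (drop (size u) v).
rewrite -{1}(cat_take_drop (size u) v); congr cat.
by rewrite Hv take_prefix_of // -Hu.
Qed.

Lemma xi_prefix_eq u v : xi_prefix u -> xi_prefix v -> size u = size v -> u = v.
Proof. by move=> -> -> ; rewrite !size_prefix_of => ->. Qed.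

Lemma nth_xi_prefix u t : xi_prefix u -> t < size u -> nth la u t = xi t.
Proof. by move=> -> ; rewrite size_prefix_of => Ht; rewrite nth_mkseq. Qed.

Lemma factorP w : factor xi w <-> exists u, xi_prefix (u ++ w).
Proof.
split=> [[i Hw]|[u Hu]].
  exists (prefix_of xi i).
  by rewrite /xi_prefix size_cat size_prefix_of prefix_ofD -Hw.
exists (size u); move: Hu; rewrite /xi_prefix size_cat prefix_ofD.
move/(congr1 (drop (size u))).
by rewrite drop_size_cat // drop_size_cat // size_prefix_of.
Qed.

Lemma factor_infix (u w v : word) : factor xi (u ++ w ++ v) -> factor xi w.
Proof.
case/factorP=> p; rewrite !catA => /xi_prefix_catl H.
by apply/factorP; exists (p ++ u).
Qed.

Lemma special_suffix (u w : word) : suffix u w -> special xi w -> special xi u.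
Proof.
case/suffixP=> p ->; rewrite /special !rcons_cat.
move=> [Ha Hb]; split; apply: (@factor_infix p _ [::]); rewrite cats0 //.
Qed.

(** * Recurrence and images of special words in the fixed point *)

Hypothesis fix_xi : fixed_point sg xi.

Lemma xi_prefix_subst u : xi_prefix u -> xi_prefix (subst sg u).
Proof.
move=> Hu; apply: (@eq_from_nth _ la) => [|n Hn]; rewrite ?size_prefix_of //.
rewrite nth_mkseq // -fix_xi /subst_inf.
have Hv := xi_prefix_of n.+1; set v := prefix_of xi n.+1 in Hv *.
have Hnv : n < size (subst sg v).
  by apply: leq_trans (size_subst_ge1 v); rewrite size_prefix_of.
(* Of two prefixes of [xi] one extends the other, so their images agree at [n], which lies inside
   both. *)
have [Huv|/ltnW Hvu] := leqP (size u) (size v).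
  by have [s ->] := xi_prefix_ext Hu Hv Huv; rewrite subst_cat nth_cat Hn.
by have [s ->] := xi_prefix_ext Hv Hu Hvu; rewrite subst_cat nth_cat Hnv.
Qed.

(** This supplies occurrences with long left context. The letter [xi 0] recurs since each block
    contains it; applying the substitution then at least doubles the recurring prefix. *)
Lemma prefix_of_recurrent n k :
  exists2 u, k <= size u & xi_prefix (u ++ prefix_of xi n).
Proof.
case: n => [|n].
  by exists (prefix_of xi k); rewrite ?size_prefix_of // cats0; apply: xi_prefix_of.
elim: n k => [|n IHn] k.
  have := full (xi k) (xi 0); rewrite -has_count has_pred1 => /splitPr Hs.
  have := xi_prefix_subst (xi_prefix_of k.+1).
  rewrite prefix_ofS subst_rcons; case: Hs => s1 s2.
  rewrite -cat_rcons !catA => /xi_prefix_catl; rewrite -cats1 catA => H.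
  exists (subst sg (prefix_of xi k) ++ s1) => //.
  have := size_subst_ge1 (prefix_of xi k); rewrite size_prefix_of size_cat; lia.
have [u Hu /xi_prefix_subst] := IHn k.
rewrite subst_cat => H.
exists (subst sg u); first exact: leq_trans Hu (size_subst_ge1 u).
have [s Es] : exists s, subst sg (prefix_of xi n.+1) = prefix_of xi n.+2 ++ s.
  apply: xi_prefix_ext (xi_prefix_of _) (xi_prefix_subst (xi_prefix_of _)) _.
  have := size_subst_ge (prefix_of xi n.+1); rewrite !size_prefix_of; lia.
by move: H; rewrite Es catA => /xi_prefix_catl.
Qed.

Lemma factor_recurrent w k :
  factor xi w -> exists2 u, k <= size u & xi_prefix (u ++ w).
Proof.
case/factorP=> p Hp; have [u Hu] := prefix_of_recurrent (size (p ++ w)) k.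
rewrite -Hp catA => H; exists (u ++ p) => //.
by rewrite size_cat; apply: leq_trans Hu (leq_addr _ _).
Qed.

(** An occurrence preceded by at least [size W0] letters has an image preceded by [W0], and the
    image of the next letter begins with that letter. *)
Lemma special_T w : special xi w -> special xi (T w).
Proof.
have Hc c : factor xi (rcons w c) -> factor xi (rcons (T w) c).
  case/(factor_recurrent (size W0)) => u Hu /xi_prefix_subst.
  rewrite subst_cat subst_rcons; have [s ->] := cat_marked c => H.
  have /suffixP[p Ep] : suffix W0 (subst sg u).
    apply: suffix_le (suffix_W0_T u) (suffix_suffix _ _) _.
    exact: leq_trans Hu (size_subst_ge1 u).
  apply/factorP; exists p; move: H.
  by rewrite Ep -cat_rcons !catA => /xi_prefix_catl; rewrite -cats1 !catA -cats1 !catA.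
by case=> /Hc Ha /Hc Hb.
Qed.

(** * Cutting positions *)

Lemma cutting_next p : cutting sg xi p ->
  cutting sg xi (p + size (sg (xi p))) /\
  forall r, r < size (sg (xi p)) -> xi (p + r) = nth la (sg (xi p)) r.
Proof.
case=> k ->; set u := prefix_of xi k.
have := xi_prefix_subst (xi_prefix_of k.+1).
rewrite prefix_ofS subst_rcons -/u => H.
have Hr r : r < size (sg (xi k)) -> xi (size (subst sg u) + r) = nth la (sg (xi k)) r.
  move=> Hr; rewrite -(nth_xi_prefix H) ?size_cat ?ltn_add2l //.
  by rewrite nth_cat ltnNge leq_addr /= addKn.
(* A block begins with its own letter, so the letter read at a cutting position names the block that
   starts there. *)
have E : xi (size (subst sg u)) = xi k.
  by have := Hr 0 (size_sg_gt0 _); rewrite addn0 nth_marked.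
rewrite E; split=> //; exists k.+1.
by rewrite prefix_ofS subst_rcons size_cat.
Qed.

Lemma cutting_ge q :
  exists p, cutting sg xi p /\ q <= p < q + maxn (size (sg la)) (size (sg lb)).
Proof.
have Hs c : size (sg c) <= maxn (size (sg la)) (size (sg lb)) by case: c; lia.
elim: q => [|q [p [Hp Hpq]]].
  by exists 0; split; [exists 0 | have := Hs la; have := size_sg_gt0 la; lia].
have [E|Hne] := eqVneq p q; last by exists p; split=> //; lia.
exists (p + size (sg (xi p))); split; first by case: (cutting_next Hp).
have := Hs (xi p); have := size_sg_gt0 (xi p); lia.
Qed.

(* Two aligned cutting positions propagate to the right as long as the two
   occurrences agree, since the first letter of a block determines it; and the
   occurrences cannot begin to differ in the interior of a block. *)
Lemma cutting_forward i j n t :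
  (forall r, r < n -> xi (i + r) = xi (j + r)) -> xi (i + n) <> xi (j + n) ->
  t <= n -> cutting sg xi (i + t) -> cutting sg xi (j + t) ->
  cutting sg xi (i + n) /\ cutting sg xi (j + n).
Proof.
move=> Heq Hne.
have [d] := ubnP (n - t); elim: d t => // d IHd t Hd Htn Hi Hj.
have [<-//|Htn'] := eqVneq t n.
have {}Htn : t < n by lia.
have [Hi' Hbi] := cutting_next Hi; have [Hj' Hbj] := cutting_next Hj.
rewrite -(Heq t Htn) in Hj' Hbj.
have [Hle|Hlt] := leqP (t + size (sg (xi (i + t)))) n.
  apply: (IHd (t + size (sg (xi (i + t))))); rewrite ?addnA //.
  by have := size_sg_gt0 (xi (i + t)); lia.
have Hr : n - t < size (sg (xi (i + t))) by lia.
by case: Hne; move: (Hbi _ Hr) (Hbj _ Hr); rewrite -!addnA subnKC ?(ltnW Htn) // => -> ->.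
Qed.

(** A block begins where [U] ends and, starting with [c], it is the image of [c]; [P] is the prefix
    of [xi] whose image ends there. *)
Lemma cutting_prefix u U c : cutting sg xi (size (u ++ U)) ->
  xi_prefix (u ++ rcons U c) ->
  exists P, suffix U (subst sg P) /\ factor xi (rcons P c).
Proof.
move=> [k Hk] H; exists (prefix_of xi k).
have HP := xi_prefix_subst (xi_prefix_of k).
have HU : xi_prefix (u ++ U).
  by move: H; rewrite -cats1 catA => /xi_prefix_catl.
rewrite -(xi_prefix_eq HU HP Hk) suffix_suffix; split=> //.
suff -> : c = xi k.
  by rewrite -prefix_ofS; apply/factorP; exists [::]; apply: xi_prefix_of.
have Hc : xi (size (u ++ U)) = c.
  rewrite -(nth_xi_prefix H); last by rewrite !size_cat size_rcons addnS.
  by rewrite -cats1 catA nth_cat ltnn subnn.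
have := xi_prefix_subst (xi_prefix_of k.+1).
rewrite prefix_ofS subst_rcons; have [s ->] := cat_marked (xi k) => H'.
rewrite -Hc Hk -(nth_xi_prefix H'); last by rewrite size_cat addnS ltnS leq_addr.
by rewrite nth_cat ltnn subnn.
Qed.

(** * Desubstitution and descent of weak and strong words *)

Variable C : nat.
Hypothesis recogC : recognizability_constant sg xi C.
Notation L := (Lconst sg C).

Lemma special_desubst U :
  special xi U -> L < size U -> exists2 V, special xi V & suffix U (T V).
Proof.
move=> [/factorP[u Hu] /factorP[v Hv]] HL.
set m := maxn (size (sg la)) (size (sg lb)).
have {}HL : 2 * C + m < size U by apply: leq_ltn_trans HL; rewrite leq_maxl.
have nthU w c r : xi_prefix (w ++ rcons U c) -> r < size U -> xi (size w + r) = nth la U r.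
  move=> Hw Hr; rewrite -(nth_xi_prefix Hw) ?size_cat ?size_rcons; last by lia.
  by rewrite nth_cat ltnNge leq_addr addKn nth_rcons Hr.
have nthc w c : xi_prefix (w ++ rcons U c) -> xi (size w + size U) = c.
  move=> Hw; rewrite -(nth_xi_prefix Hw) ?size_cat ?size_rcons; last by lia.
  by rewrite nth_cat ltnNge leq_addr addKn nth_rcons ltnn eqxx.
have Heq r : r < size U -> xi (size u + r) = xi (size v + r).
  by move=> Hr; rewrite (nthU _ _ _ Hu Hr) (nthU _ _ _ Hv Hr).
(* Starting [C] letters inside [U] and going fewer than [m] further keeps the window of radius [C]
   within [U], so recognizability moves the cutting position to the other occurrence. *)
have [p [Hp Hpm]] := cutting_ge (size u + C).
set t := p - size u.
have Ep : p = size u + t by rewrite /t; lia.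
have Hq : cutting sg xi (size v + t).
  apply: (@recogC p) => //; try by rewrite /t; lia.
  apply/eq_in_map => r; rewrite mem_iota add0n => /andP[_ Hr].
  have E w : size w + t - C + r = size w + (t - C + r) by rewrite /t; lia.
  by rewrite Ep !E; apply: Heq; rewrite /t; lia.
have Htn : t <= size U by rewrite /t; lia.
rewrite Ep in Hp.
(* The occurrences are followed by different letters, so the cutting positions propagate up to the
   end of [U]. *)
have [|Hcu Hcv] := cutting_forward Heq _ Htn Hp Hq.
  by rewrite (nthc _ _ Hu) (nthc _ _ Hv).
rewrite -size_cat in Hcu; rewrite -size_cat in Hcv.
have [P [HP HPa]] := cutting_prefix Hcu Hu.
have [Q [HQ HQb]] := cutting_prefix Hcv Hv.
(* The common suffix [V] inherits the continuation [la] from [P] and [lb] from [Q]. *)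
have [V [HVP HVQ HV]] := T_common_suffix (suffix_catr W0 HP) (suffix_catr W0 HQ).
have HVc R c : suffix V R -> factor xi (rcons R c) -> factor xi (rcons V c).
  case/suffixP=> x ->; rewrite rcons_cat => HR.
  by apply: (@factor_infix x _ [::]); rewrite cats0.
by exists V => //; split; [apply: HVc HVP HPa | apply: HVc HVQ HQb].
Qed.

Lemma special_behead c w : special xi (c :: w) -> special xi w.
Proof. exact: special_suffix (suffix_cons _ _). Qed.

Lemma strong_special w : strong xi w -> forall c, special xi (c :: w).
Proof. by case=> _ Ha Hb []. Qed.

Lemma weak_not_special w : weak xi w -> forall c, ~ special xi (c :: w).
Proof. by case=> _ Ha Hb []. Qed.

Lemma strong_T V : strong xi V -> strong xi (T V).
Proof.
move=> HV; have [x [x_inj Hx]] := T_marks.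
have Hc c : special xi (x c :: T V).
  apply: special_suffix (Hx c V (c :: V) (suffix_refl _)) _.
  exact/special_T/strong_special.
have Hc' c : special xi (c :: T V).
  have := Hc la; have := Hc lb; have : x la <> x lb by move/x_inj.
  by case: (x la) => //; case: (x lb) => //; case: c.
by split; [apply: special_behead (Hc' la) | |].
Qed.

(** A special [z :: T V] would be a suffix of some [T V'] with [V'] special. Then [V'] can neither
    part from [V] nor be a suffix of it, so it extends [V] to the left, against weakness. *)
Lemma weak_T V : weak xi V -> L < size (T V) -> weak xi (T V).
Proof.
move=> HV HL; have [x [x_inj Hx]] := T_marks.
suff Hz z : ~ special xi (z :: T V).
  by split; [apply: special_T; case: HV | apply: Hz | apply: Hz].
case/special_desubst => [|V' HV' Hs]; first by rewrite ltnW.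
have Hs' := suffix_trans (suffix_cons _ _) Hs.
have [/suffixP[p EV']|H|[q [c [H1 H2]]]] := suffix_compare V V'.
- case/lastP: p EV' => [|p c] EV'.
    by have := size_suffix Hs; rewrite EV' /= ltnn.
  case: (weak_not_special HV (c := c)); apply: special_suffix HV'.
  by rewrite EV' cat_rcons suffix_suffix.
- by have := size_suffix Hs; have := size_suffix (suffix_T H) => /=; lia.
- have := suffix_cons_neq (suffix_trans (Hx _ _ _ H1) Hs') (Hx _ _ _ H2).
  by move/x_inj; case: (c).
Qed.

(** The preimages of the two left extensions part at a word [Q] with [T Q = U]; both left extensions
    of [Q] are special as suffixes of these preimages. *)
Lemma strong_desubst U :
  strong xi U -> L < size U -> exists2 V, strong xi V & U = T V.
Proof.
move=> [_ Ha Hb] HL.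
have [|V HV HUV] := special_desubst Ha; first by rewrite ltnW.
have [|V' HV' HUV'] := special_desubst Hb; first by rewrite ltnW.
have [Q [c [-> H1 H2]]] := T_branch HUV HUV'.
have Hc := special_suffix H1 HV; have Hc' := special_suffix H2 HV'.
exists Q => //; split; first exact: special_behead Hc.
  by case: c Hc Hc' {H1 H2}.
by case: c Hc Hc' {H1 H2}.
Qed.

(** Were [U] a proper suffix of the special word [T V], a left extension of [U] would be special. So
    [U = T V], and [T] carries a special left extension of [V] to one of [U]. *)
Lemma weak_desubst U :
  weak xi U -> L < size U -> exists2 V, weak xi V & U = T V.
Proof.
move=> HU HL; have [HU0 _ _] := HU.
have [V HV /suffixP[p Ep]] := special_desubst HU0 HL.
have EU : U = T V.
  case/lastP: p Ep => [|p c] Ep; first by [].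
  case: (weak_not_special HU (c := c)); apply: special_suffix (special_T HV).
  by rewrite Ep cat_rcons suffix_suffix.
exists V => //.
suff Hc c : ~ special xi (c :: V) by [].
move=> /special_T; have [x [x_inj Hx]] := T_marks.
move/(special_suffix (Hx c V (c :: V) (suffix_refl _))).
by rewrite -EU; apply: weak_not_special.
Qed.

(** The sign freed of the range condition in [sgn]: the number of special left extensions of [w],
    minus one if [w] itself is special. *)
Definition defect (w : word) : int :=
  ((`[< strong xi w >] : nat)%:Z - (`[< weak xi w >] : nat)%:Z)%R.

Lemma defect_T V : L < size (T V) -> defect (T V) = defect V.
Proof.
move=> HL; congr (_%:Z - _%:Z)%R; congr nat_of_bool; apply/asboolP/asboolP.
- by move=> /strong_desubst/(_ HL)[W HW /T_inj ->].
- exact: strong_T.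
- by move=> /weak_desubst/(_ HL)[W HW /T_inj ->].
- by move=> HV; apply: weak_T.
Qed.

Lemma sgn_defect w : in_range T L w -> sgn xi T L w = defect w.
Proof.
move=> Hr; rewrite /sgn /defect.
have -> : `[< initial_weak xi T L w >] = `[< weak xi w >].
  by apply/asboolP/asboolP => [[]|].
have -> : `[< initial_strong xi T L w >] = `[< strong xi w >].
  by apply/asboolP/asboolP => [[]|].
by case: asboolP => [[_ Ha _]|_]; case: asboolP => [[_ Hb _]|_].
Qed.

Lemma size_iter_T_gt w m : in_range T L w -> 0 < m -> L < size (iter m T w).
Proof.
case=> _ _ HL Hm; apply: leq_trans HL _.
exact: (Tlen_le w Hm).
Qed.

Lemma defect_iter_T w m : in_range T L w -> defect (iter m T w) = defect w.
Proof.
move=> Hw; elim: m => // m IHm.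
by rewrite -IHm; apply: defect_T; apply: (size_iter_T_gt Hw (m := m.+1)).
Qed.

Lemma defect_neq0P w : reflect (strong xi w \/ weak xi w) (defect w != 0%R).
Proof.
rewrite /defect; apply: (iffP idP).
  by case: asboolP => [|_]; [left | case: asboolP => // ?; right].
have Hsw : strong xi w -> weak xi w -> False by move=> [_ Ha _] [].
by case=> H; case: asboolP => // Hs; case: asboolP => // Hw; case: Hsw.
Qed.

(** Each desubstitution shortens the word and keeps the defect, so the descent ends at a word of
    length at most [L] whose image is longer than [L]. *)
Lemma defect_desubst U : L < size U -> defect U != 0%R ->
  exists S m, [/\ 0 < m, initial_special xi T L S & U = iter m T S].
Proof.
have [n] := ubnP (size U); elim: n U => // n IHn U Hn HL HU.
have [V EU] : exists V, U = T V.
  have /defect_neq0P[/strong_desubst|/weak_desubst] := HU;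
  by case/(_ HL) => V _ ->; exists V.
have HV : defect V != 0%R by rewrite -defect_T -EU.
have HVU : size V < size U.
  case: V {HV} EU HL => [|c V] -> HL; first by apply: leq_ltn_trans HL.
  by have := size_T_ge (c :: V) => /=; lia.
have [HVL|HLV] := leqP (size V) L.
  exists V, 1; split=> //.
  have Hr : in_range T L V.
    split=> //; last by rewrite -EU.
    (* The empty word is excluded: its image is [W0], which is shorter than [L]. *)
    case: V EU {HV HVU HVL} => // EU.
    have := size_W0; move: HL; rewrite EU size_T /= addn0 /Lconst; lia.
  by case/defect_neq0P: HV; [right | left].
have [|S [m [Hm HS EV]]] := IHn V _ HLV HV; first by lia.
by exists S, m.+1; split=> //; rewrite EU EV.
Qed.

(** * Differences of the number of special words *)

Lemma num_special_sum n : ((num_special xi n)%:Z =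
  \sum_(w : n.-tuple letter) (`[< special xi w >] : nat)%:Z)%R.
Proof.
rewrite /num_special -sum1dep_card big_mkcond /= -(big_morph Posz PoszD (erefl 0%Z)).
by congr Posz; apply: eq_bigr => w _; case: asboolP.
Qed.

(** Deleting the first letter of a special word leaves a special word, so the special words of
    length [n.+1] are the left extensions that [defect] counts. *)
Lemma num_specialS n : ((num_special xi n.+1)%:Z =
  (num_special xi n)%:Z + \sum_(w : n.-tuple letter) defect w)%R.
Proof.
rewrite !num_special_sum (sum_tuple_cons _ (fun w => (`[< special xi w >] : nat)%:Z%R)).
rewrite -!big_split; apply: eq_bigr => w _ /=; rewrite /defect.
have Ha : special xi (la :: w) -> special xi w by apply: special_behead.
have Hb : special xi (lb :: w) -> special xi w by apply: special_behead.
have -> : `[< strong xi w >] = `[< special xi (la :: w) >] && `[< special xi (lb :: w) >].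
  by apply/asboolP/andP => [[_ /asboolP ? /asboolP]|[/asboolP ? /asboolP]];
    [|split=> //; apply: Ha].
have -> : `[< weak xi w >] = [&& `[< special xi w >], ~~ `[< special xi (la :: w) >]
                              & ~~ `[< special xi (lb :: w) >]].
  by apply/asboolP/and3P => -[/asboolP ? /asboolPn ? /asboolPn].
case: (asboolP (special xi (la :: w))) => Ha';
  case: (asboolP (special xi (lb :: w))) => Hb';
  case: (asboolP (special xi w)) => // Hw; by [case: Hw; apply: Ha | case: Hw; apply: Hb].
Qed.

(** * Exponents and the order of the lengths *)

Variables (K : nat) (Ss : nat -> word) (e : nat -> nat).
Variables m1 m2 : word -> word -> nat.
Hypothesis lenT : length_comparison T m1 m2.
Hypothesis enumS : enumerates_initial xi T L K Ss.
Hypothesis e1E : e 1 = first_exponent m1 m2 K Ss.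
Hypothesis ejP : forall j, 2 <= j <= K ->
  Tlen T (e 1) (Ss 1) <= Tlen T (e j) (Ss j) < Tlen T (e 1).+1 (Ss 1).
Hypothesis K_gt0 : 0 < K.

Lemma Ss_range k : 1 <= k <= K -> in_range T L (Ss k).
Proof.
move=> Hk; have [_ /(_ (Ss k))[_]] := enumS.
by case=> [|[] ? |[] ?]; first by exists k.
Qed.

Lemma Ss_neq0 k : 1 <= k <= K -> Ss k != [::].
Proof. by case/Ss_range => + _ _; rewrite -size_eq0 -lt0n. Qed.

Lemma m_lt_e1 i k : 1 <= i <= K -> 1 <= k <= K ->
  m1 (Ss i) (Ss k) < e 1 /\ m2 (Ss i) (Ss k) < e 1.
Proof.
move=> Hi Hk; rewrite e1E /first_exponent !ltnS.
set F := fun i => \max_(1 <= j < K.+1) maxn (m1 (Ss i) (Ss j)) (m2 (Ss i) (Ss j)).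
have Hmem j : 1 <= j <= K -> j \in index_iota 1 K.+1 by rewrite mem_index_iota ltnS.
have HF : F i <= \max_(1 <= i < K.+1) F i by apply: leq_bigmax_seq; rewrite ?Hmem.
have HG : maxn (m1 (Ss i) (Ss k)) (m2 (Ss i) (Ss k)) <= F i.
  pose G j := maxn (m1 (Ss i) (Ss j)) (m2 (Ss i) (Ss j)).
  by apply: (@leq_bigmax_seq _ _ xpredT G); rewrite ?Hmem.
by split; apply: leq_trans HF; apply: leq_trans HG; rewrite ?leq_maxl ?leq_maxr.
Qed.

(** Both alternatives of the comparison weaken to this chain; they need to be told apart only to
    decide equality of lengths. *)
Lemma lengths_interlace i k : 1 <= i <= K -> 1 <= k <= K ->
  forall r, Tlen T (m1 (Ss i) (Ss k) + r) (Ss i) <= Tlen T (m2 (Ss i) (Ss k) + r) (Ss k)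
            < Tlen T (m1 (Ss i) (Ss k) + r).+1 (Ss i).
Proof.
move=> /Ss_neq0 Hi /Ss_neq0 Hk r.
by case: (lenT Hi Hk) => /(_ r)[] => [->|/ltnW ->] ->; rewrite ?leqnn.
Qed.

(** [Ss k] has length at most [L] and [T (Ss 1)] is longer than [L], so the comparison by size
    applies to these two words. *)
Lemma Tlen_gt_two k r : 1 <= k <= K -> Tlen T r (Ss k) < Tlen T r.+2 (Ss 1).
Proof.
move=> /Ss_range[_ HkL _]; have [_ _ HL] : in_range T L (Ss 1) by apply: Ss_range; lia.
have := Tlen_gt_of_size r (leq_ltn_trans HkL HL).
by rewrite /Tlen -!iterSr.
Qed.

(** Beyond the thresholds [p] and [q] the two sequences of lengths alternate, and the choice of
    [e k] forces [e k - q = e 1 - p]. The bound on [e 1] then follows from [p <= q.+1]. *)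
Lemma exponent_shift k : 1 <= k <= K ->
  e 1 <= (e k).+1 /\ forall r, e 1 <= r.+1 ->
    Tlen T r (Ss 1) <= Tlen T (r + e k - e 1) (Ss k) < Tlen T r.+1 (Ss 1).
Proof.
move=> Hk; have H1 : 1 <= 1 <= K by lia.
have [->|k_neq1] := eqVneq k 1.
  by split=> // r _; rewrite addnK leqnn Tlen_lt_S // Ss_neq0.
have Hk2 : 2 <= k <= K by lia.
have /andP[Hle Hlt] := ejP Hk2.
set p := m1 (Ss 1) (Ss k); set q := m2 (Ss 1) (Ss k).
have Hpq := lengths_interlace H1 Hk; rewrite -/p -/q in Hpq.
have [Hp Hq] := m_lt_e1 H1 Hk; rewrite -/p -/q in Hp Hq.
(* Otherwise [T^p(S_1)], with [p] at least [q + 2], would be no longer than [T^q(S_k)], against the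
   two-step bound. *)
have Hqp : p <= q.+1.
  rewrite leqNgt; apply/negP => Hqp.
  have := Hpq 0; rewrite !addn0 => /andP[H _].
  have := Tlen_gt_two q Hk; have := Tlen_le (Ss 1) Hqp; lia.
have Eek : e k + p = q + e 1.
  have [H|H|//] := ltngtP (e k + p) (q + e 1).
  - have := Hpq ((e 1).-1 - p) => /andP[_].
    have -> : (p + ((e 1).-1 - p)).+1 = e 1 by lia.
    have := Tlen_le (Ss k) (m := e k) (n := q + ((e 1).-1 - p)); lia.
  - have := Hpq ((e 1).+1 - p) => /andP[+ _].
    have -> : p + ((e 1).+1 - p) = (e 1).+1 by lia.
    have := Tlen_le (Ss k) (m := q + ((e 1).+1 - p)) (n := e k); lia.
split; first by lia.
move=> r Hr; have := Hpq (r - p).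
have -> : p + (r - p) = r by lia.
by have -> : q + (r - p) = r + e k - e 1 by lia.
Qed.

Notation N := (Npos T K Ss e).

Lemma NposE k j : 1 <= k <= K -> N k j = Tlen T (j + e k) (Ss k).
Proof. by move=> Hk; rewrite /Npos ltn_eqF /Tlen -?iterD //; lia. Qed.

Lemma Npos_last j : N K.+1 j = N 1 j.+1.
Proof. by rewrite [RHS]NposE ?K_gt0 // /Npos eqxx /Tlen -iterD. Qed.

Lemma Npos_bounds k j : 1 <= k <= K -> N 1 j <= N k j < N 1 j.+1.
Proof.
move=> Hk; rewrite !NposE ?K_gt0 //.
have [_ /(_ (j + e 1))] := exponent_shift Hk.
by rewrite addnAC addnK addSn; apply; lia.
Qed.

Lemma Npos_ltS j : N 1 j < N 1 j.+1.
Proof. by have /andP[] := Npos_bounds (k := 1) j K_gt0; lia. Qed.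

Lemma Npos_gt_L j : L < N 1 j.
Proof.
rewrite NposE ?K_gt0 //; apply: size_iter_T_gt; first by apply: Ss_range; lia.
by rewrite e1E addnS.
Qed.

(** The lengths of the iterates of [Ss k] interlace with the ends of the levels, so each level
    contains only one of them. *)
Lemma interval_exponent k r j : 1 <= k <= K ->
  N 1 j <= Tlen T r (Ss k) < N 1 j.+1 -> r = j + e k.
Proof.
move=> Hk; have := NposE j (k := 1) K_gt0; have := NposE j.+1 (k := 1) K_gt0 => -> ->.
have [He Hs] := exponent_shift Hk => /andP[Hr1 Hr2].
have e1_gt0 : 0 < e 1 by rewrite e1E.
have [H|H|//] := ltngtP r (j + e k).
- have := Hs (j + e 1).-1; have -> : (j + e 1).-1.+1 = j + e 1 by lia.
  case/(_ _)/andP => [|_]; first by lia.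
  have := Tlen_le (Ss k) (m := r) (n := (j + e 1).-1 + e k - e 1); lia.
- have := Hs (j + e 1).+1; case/(_ _)/andP => [|+ _]; first by lia.
  have := Tlen_le (Ss k) (m := (j + e 1).+1 + e k - e 1) (n := r).
  rewrite addSn in Hr2; lia.
Qed.

(** Level 0 aligns the exponents, [e i + q = e k + p], and they have reached the thresholds [p] and
    [q]; so a single alternative of the comparison decides order and equality at every level. *)
Lemma Npos_order i k j : 1 <= i <= K -> 1 <= k <= K -> N i 0 <= N k 0 ->
  N i j <= N k j /\ (N i j == N k j) = (N i 0 == N k 0).
Proof.
move=> Hi Hk; rewrite !NposE // => Hik; rewrite !add0n in Hik.
have Hpq := lengths_interlace Hi Hk; have [] := m_lt_e1 Hi Hk.
set p := m1 (Ss i) (Ss k) in Hpq *; set q := m2 (Ss i) (Ss k) in Hpq * => Hp Hq.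
have [Hei _] := exponent_shift Hi; have [Hek _] := exponent_shift Hk.
have Eab : e i + q = e k + p.
  have [H|H|//] := ltngtP (e i + q) (e k + p).
  - have := Hpq (e i - p).+1 => /andP[+ _].
    have -> : p + (e i - p).+1 = (e i).+1 by lia.
    have := Tlen_le (Ss k) (m := q + (e i - p).+1) (n := e k).
    have /andP[+ _] := Npos_bounds 1 Hi; have /andP[_] := Npos_bounds 0 Hk.
    rewrite (NposE 1 Hi) (NposE 0 Hk) add0n add1n; lia.
  - have := Hpq (e k - q) => /andP[_].
    have := Tlen_le (Ss i) (m := (p + (e k - q)).+1) (n := e i).
    have -> : q + (e k - q) = e k by lia.
    lia.
have [a Ei Ek] : exists2 a, forall d, d + e i = p + (d + a) & forall d, d + e k = q + (d + a).
  by exists (e i - p) => d; lia.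
rewrite !Ei !Ek; split; first by case/andP: (Hpq (j + a)).
have := lenT (Ss_neq0 Hi) (Ss_neq0 Hk); rewrite -/p -/q => -[Hs|Hs].
  by have [-> _] := Hs (j + a); have [-> _] := Hs (0 + a); rewrite !eqxx.
have [H1 _] := Hs (j + a); have [H2 _] := Hs (0 + a).
by rewrite !ltn_eqF.
Qed.

(** * Summation over the levels *)

Hypothesis sortedS : forall k, 1 <= k < K ->
  Tlen T (e k) (Ss k) <= Tlen T (e k.+1) (Ss k.+1).

Lemma Npos_homo j k : 1 <= k <= K -> N k j <= N k.+1 j.
Proof.
move=> Hk; have [->|Hne] := eqVneq k K.
  have HKK : 1 <= K <= K by lia.
  by have /andP[_ /ltnW] := Npos_bounds j HKK; rewrite Npos_last.
have Hk1 : 1 <= k.+1 <= K by lia.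
have [|//] := @Npos_order k k.+1 j Hk Hk1.
by rewrite (NposE 0 Hk) (NposE 0 Hk1) !add0n; apply: sortedS; lia.
Qed.

Lemma Npos_eq j i k : 1 <= i <= K -> 1 <= k <= K ->
  (N i j == N k j) = (Tlen T (e i) (Ss i) == Tlen T (e k) (Ss k)).
Proof.
move=> Hi Hk; have := NposE 0 Hi; have := NposE 0 Hk; rewrite !add0n => <- <-.
case/orP: (leq_total (N i 0) (N k 0)) => H.
  by have [] := Npos_order j Hi Hk H.
by rewrite eq_sym [RHS]eq_sym; have [] := Npos_order j Hk Hi H.
Qed.

(** After cancelling common iterations, one word is an iterate of the other; a proper iterate would
    be longer than [L], the other word is not. *)
Lemma iter_T_range_inj S S' m m' :
  in_range T L S -> in_range T L S' -> iter m T S = iter m' T S' -> S = S'.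
Proof.
wlog Hmm : S S' m m' / m <= m'.
  by move=> H HS HS' E; case/orP: (leq_total m m') => Hm; [|symmetry];
    [apply: H Hm HS HS' E | apply: H Hm HS' HS (esym E)].
move=> [_ HS _] HS'; rewrite -(subnKC Hmm) iterD => /iter_T_inj ES.
case: (posnP (m' - m)) ES => [-> //|Hlt] ES.
by have := size_iter_T_gt HS' Hlt; rewrite -ES ltnNge HS.
Qed.

(** At these lengths the words of nonzero defect are the [T^(j + e k)(S_k)] of length [n], each
    arising from one index only. *)
Lemma sum_defect_level j n : N 1 j <= n < N 1 j.+1 ->
  (\sum_(w : n.-tuple letter) defect w =
    \sum_(1 <= k < K.+1) sgn xi T L (Ss k) * (N k j == n)%:R)%R.
Proof.
move=> Hn; have HL : L < n by have := Npos_gt_L j; lia.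
have sgnE k : 1 <= k <= K -> forall m, sgn xi T L (Ss k) = defect (iter m T (Ss k)).
  by move=> Hk m; rewrite defect_iter_T ?sgn_defect //; apply: Ss_range.
transitivity (\sum_(w : n.-tuple letter) \sum_(1 <= k < K.+1)
    sgn xi T L (Ss k) * (iter (j + e k) T (Ss k) == w)%:R)%R; last first.
  rewrite exchange_big; apply: eq_big_nat => k Hk /=.
  by rewrite -mulr_sumr sum_tuple_eq NposE.
apply: eq_bigr => w _; have [E|Hw] := eqVneq (defect w) 0%R.
  rewrite E big_nat big1 // => k Hk.
  case: eqP => [Ek|_]; last by rewrite mulr0.
  by rewrite (sgnE k Hk (j + e k)) Ek E mul0r.
have [||S [m [Hm HS Ew]]] := @defect_desubst w; rewrite ?size_tuple //.
have [Sinj /(_ S)[/(_ HS)[k Hk ES] _]] := enumS.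
have Em : m = j + e k.
  apply: interval_exponent Hk _.
  by rewrite ES /Tlen -Ew size_tuple.
rewrite (bigD1_seq k) ?iota_uniq //=; last by rewrite mem_index_iota ltnS.
rewrite (sgnE k Hk m) -Em ES -Ew eqxx mulr1.
rewrite big_seq_cond big1 ?addr0 // => i; rewrite mem_index_iota ltnS => /andP[Hi Hik].
case: eqP => [Ei|_]; last by rewrite mulr0.
case/eqP: Hik; apply: Sinj => //; rewrite ES.
apply: (iter_T_range_inj (m := j + e i) (m' := m)); last by rewrite Ei Ew.
  exact: Ss_range.
by rewrite -ES; apply: Ss_range.
Qed.

(** Telescoping from the left end of the level: [Ss k] contributes its sign once the length [N k j]
    is reached. *)
Lemma num_special_level n j : N 1 j <= n < N 1 j.+1 ->
  ((num_special xi n.+1)%:Z = (num_special xi (N 1%N j))%:Z +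
     \sum_(1 <= k < K.+1) sgn xi T L (Ss k) * (N k j <= n)%N%:R)%R.
Proof.
move=> Hn.
have Htel : ((num_special xi n.+1)%:Z - (num_special xi (N 1%N j))%:Z =
    \sum_(N 1%N j <= m < n.+1) \sum_(w : m.-tuple letter) defect w)%R.
  rewrite -(telescope_sumr (fun m => (num_special xi m)%:Z%R)); last by lia.
  by apply: eq_bigr => m _; rewrite num_specialS addrC addKr.
rewrite -[LHS](subrK (num_special xi (N 1%N j))%:Z)%R Htel addrC; congr (_ + _)%R.
transitivity (\sum_(N 1%N j <= m < n.+1) \sum_(1 <= k < K.+1)
    sgn xi T L (Ss k) * (N k j == m)%:R)%R.
  by apply: eq_big_nat => m Hm; apply: (@sum_defect_level j); lia.
rewrite exchange_big; apply: eq_big_nat => k Hk /=.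
rewrite -mulr_sumr sum_eq_nat ?ltnS //.
by case/andP: (Npos_bounds j (k := k) Hk).
Qed.

Lemma special_recurrence n j : N 1 j <= n < N 1 j.+1 ->
  ((num_special xi n.+1)%:Z = (num_special xi (N 1%N j))%:Z +
     \sum_(1 <= k < K.+1) csum xi T L K Ss e k j * ((N k j <= n < N k.+1 j)%N)%:R)%R.
Proof.
move=> Hn; rewrite (num_special_level Hn); congr (_ + _)%R.
pose s i := sgn xi T L (Ss i).
have HnK : N 1 j <= n < N K.+1 j by rewrite Npos_last.
rewrite -(@sum_partial_class_sums K (N^~ j) (@Npos_homo j) s n HnK); last first.
  by move=> k Hk; rewrite Npos_last; apply: Npos_bounds.
apply: eq_big_nat => k Hk; congr (_ * _)%R.
rewrite /csum big_nat_cond [RHS]big_nat_cond; apply: eq_bigr => l /andP[Hl _].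
(* The coefficients compare lengths at level 0; equality there is equivalent to equality at level
   [j]. *)
rewrite /ccoef; apply: eq_big_nat => i Hi; rewrite Npos_eq //; lia.
Qed.

(** The left ends increase strictly, hence [j <= N 1 j], and the level of [n] is the largest [j]
    with [N 1 j <= n]. *)
Lemma levels_cover n : N 1 0 <= n <-> exists j, N 1 j <= n < N 1 j.+1.
Proof.
split=> [Hn|[j /andP[Hj _]]]; last first.
  by apply: leq_trans Hj; elim: j => // j IHj; apply: leq_trans IHj (ltnW (Npos_ltS j)).
have Hub j : j <= N 1 j by elim: j => // j IHj; apply: leq_ltn_trans IHj (Npos_ltS j).
have [j Hj Hmax] := ex_maxnP (ex_intro (fun j => N 1 j <= n) 0 Hn)
  (fun j Hj => leq_trans (Hub j) Hj).
by exists j; rewrite Hj ltnNge; apply/negP => /Hmax; rewrite ltnn.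
Qed.
End Words.

(** * Positivity of a primitive incidence matrix of size two *)

Section Primitive.
Set Implicit Arguments.
Unset Strict Implicit.
Local Open Scope ring_scope.

(** An intermediate index is [j], where the induction applies, or [i], where [M i j] vanishes. *)
Lemma exp_triangular_entry (R : pzRingType) (M : 'M[R]_2) (i j : 'I_2) n :
  i != j -> M i j = 0 -> (M ^+ n) i j = 0.
Proof.
move=> Hij HM; elim: n => [|n IHn]; first by rewrite expr0 mxE (negPf Hij).
rewrite exprSr mxE; apply: big1 => k _.
have [->|Hkj] := eqVneq k j; first by rewrite IHn mul0r.
have -> : k = i; last by rewrite HM mulr0.
by apply: val_inj; case: i j k Hij Hkj {HM IHn} => [[|[|?]] ?] [[|[|?]] ?] [[|[|?]] ?].
Qed.

(* A letter missing from the image of the other one would make the incidence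
   matrix triangular. *)
Lemma primitive_full sg : (forall c, ohead (sg c) = Some c) -> primitive sg ->
  forall c d, (0 < count_mem d (sg c))%N.
Proof.
move=> marked [n _ Hn] c d; have [<-|Hcd] := eqVneq c d.
  by have [s ->] := cat_marked marked c; rewrite /= eqxx.
pose idx (x : letter) : 'I_2 := if x then 1 else 0.
have idxK x : letter_of (idx x) = x by case: x.
rewrite lt0n; apply/eqP => H0.
have := Hn (idx d) (idx c); rewrite exp_triangular_entry ?ltxx //.
  by case: (c) (d) Hcd => [] [].
by rewrite mxE !idxK H0.
Qed.
End Primitive.
Theorem theorem5p1
  (sg : letter -> word) (xi : nat -> letter) (W0 : word) (C : nat)
  (m1 m2 : word -> word -> nat)
  (K : nat) (Ss : nat -> word) (e : nat -> nat)
  (Hsubst : nonerasing sg)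
  (Hmarked : well_marked sg)
  (Hprim : primitive sg)
  (Heig : nonneg_eigenvalues sg)
  (Hfix : fixed_point sg xi)
  (Hnonper : ~ ultimately_periodic xi)
  (HW0 : longest_common_suffix (sg la) (sg lb) W0)
  (HC : recognizability_constant sg xi C)
  (Hm : length_comparison (Tmap sg W0) m1 m2)
  (HK : (1 <= K)%N)
  (HS : enumerates_initial xi (Tmap sg W0) (Lconst sg C) K Ss)
  (He1 : e 1 = first_exponent m1 m2 K Ss)
  (Hej : forall j, (2 <= j <= K)%N ->
     (Tlen (Tmap sg W0) (e 1) (Ss 1) <= Tlen (Tmap sg W0) (e j) (Ss j)
        < Tlen (Tmap sg W0) (e 1).+1 (Ss 1))%N)
  (Hsorted : forall k, (1 <= k < K)%N ->
     (Tlen (Tmap sg W0) (e k) (Ss k) <= Tlen (Tmap sg W0) (e k.+1) (Ss k.+1))%N) :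
  let T := Tmap sg W0 in
  let L := Lconst sg C in
  let N := Npos T K Ss e in
  (forall n, (N 1 0 <= n)%N <-> exists j, (N 1 j <= n < N 1 j.+1)%N) /\
  (forall n j, (N 1 j <= n < N 1 j.+1)%N ->
     (num_special xi n.+1)%:Z%R =
       ((num_special xi (N 1%N j))%:Z +
        \sum_(1 <= k < K.+1)
          csum xi T L K Ss e k j * ((N k j <= n < N k.+1 j)%N)%:R)%R).
Proof.
have marked c : ohead (sg c) = Some c by case: Hmarked; case: c.
have full := primitive_full marked Hprim.
split; first exact: (levels_cover full Hm HS He1 Hej HK).
exact: (special_recurrence marked full HW0 Hfix HC Hm HS He1 Hej HK Hsorted).
Qed.
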